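(* Let $f:\mathbb{R}\to\mathbb{C}$ be a uniformly almost periodic function which is of average bounded variation, i.e. $\|f\|_{\overline{BV}}<\infty$. Let $f(x)\sim\sum_{k} A_k e^{i\lambda_k x}$ be its Fourier series, where the $\lambda_k\in\mathbb{R}$ are the Fourier exponents of $f$ and the $A_k$ are the corresponding Fourier coefficients. Then for every $j$ with $\lambda_j\neq 0$, $$|A_j|\le \frac{\|f\|_{\overline{BV}}}{|\lambda_j|}.$$
   Context: Uniformly almost periodic functions: the space of uniformly almost periodic functions is the closure, in the sup norm $\|\cdot\|_\infty$ on $\mathbb{R}$, of the set of all trigonometric polynomials $\sum_{k=0}^n c_k e^{i x\lambda_k}$ with $c_k\in\mathbb{C}$ and arbitrary real $\lambda_k$. Fourier series: for a uniformly almost periodic function $f$ the mean value $M\{f\}=\lim_{T\to\infty}\frac1T\int_a^{a+T} f(x)\,dx$ exists uniformly in $a\in\mathbb{R}$ and is independent of $a$. For $\lambda\in\mathbb{R}$ put $a(\lambda)=M\{f(x)e^{-i\lambda x}\}$. The set of $\lambda$ with $a(\lambda)\ne 0$ is at most countable; its distinct elements $\lambda_1,\lambda_2,\dots$ are called the Fourier exponents of $f$, and $A_k=a(\lambda_k)$ are the Fourier coefficients. One writes $f(x)\sim\sum_k A_k e^{i\lambda_k x}$ (no convergence is asserted). Average total variation: for $a<b$, $V_{[a,b]}(f)$ is the supremum of $\sum_{i=1}^n |f(x_i)-f(x_{i-1})|$ over all finite partitions $a=x_0<\dots<x_n=b$. The average total variation of $f$ is the limit $\|f\|_{\overline{BV}}=\overline{V}_{\mathbb{R}}(f)=\lim_{T\to\infty}\frac1T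 V_{[0,T]}(f)$. The function $f$ has average bounded variation if this limit exists and is finite. *)

(* Defs.v *)
From Stdlib Require Import Reals.
From Coquelicot Require Import Coquelicot.
Open Scope R_scope.

(* e^{i x}; Coquelicot has no complex exponential. *)
Definition cis (x : R) : C := (cos x, sin x).

Definition trig_poly (n : nat) (c : nat -> C) (lam : nat -> R) (x : R) : C :=
  sum_n (fun k => (c k * cis (x * lam k))%C) n.

Definition uniformly_almost_periodic (f : R -> C) : Prop :=
  forall eps : R, 0 < eps ->
    exists (n : nat) (c : nat -> C) (lam : nat -> R),
      forall x : R, Cmod (f x - trig_poly n c lam x) < eps.

(* The limit T -> +oo is taken uniformly in the left endpoint a. *)
Definition is_mean_value (g : R -> C) (m : C) : Prop :=
  forall eps : R, 0 < eps ->
    Rbar_locally p_infty (fun T : R => forall a : R,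
      Cmod ((/ T)%R * RInt (V := C_R_CompleteNormedModule) g a (a + T) - m)
      < eps).

(* [iota] picks the unique value satisfying [is_mean_value g] when it exists,
   and is unspecified otherwise. *)
Definition mean_value (g : R -> C) : C :=
  iota (T := C_R_CompleteNormedModule) (is_mean_value g).

Definition fourier_coeff (f : R -> C) (l : R) : C :=
  mean_value (fun x => (f x * cis (- (l * x)))%C).

Definition fourier_exponent (f : R -> C) (l : R) : Prop :=
  fourier_coeff f l <> RtoC 0.

(* f(x) ~ sum_k A_k e^{i lam_k x}: [lam] enumerates the Fourier exponents of f
   without repetition and [A] lists the corresponding coefficients.  The index
   type is arbitrary, so finite, empty and countably infinite families are all
   covered; no convergence is asserted. *)
Definition is_fourier_series (f : R -> C) {K : Type} (lam : K -> R) (A : K -> C)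
    : Prop :=
  (forall j k : K, lam j = lam k -> j = k) /\
  (forall l : R, fourier_exponent f l <-> exists k : K, lam k = l) /\
  (forall k : K, A k = fourier_coeff f (lam k)).

Definition is_partition (a b : R) (n : nat) (x : nat -> R) : Prop :=
  x 0%nat = a /\ x n = b /\ (forall i : nat, (i < n)%nat -> x i < x (S i)).

Definition variation_sum (f : R -> C) (n : nat) (x : nat -> R) : R :=
  sum_n_m (fun i => Cmod (f (x i) - f (x (i - 1)%nat))) 1 n.

(* Extended-real valued: p_infty when the sums are unbounded. *)
Definition variation (f : R -> C) (a b : R) : Rbar :=
  Lub_Rbar (fun v => exists (n : nat) (x : nat -> R),
    is_partition a b n x /\ v = variation_sum f n x).

(* The coercion [real : Rbar -> R] sends infinities to 0, hence the explicit
   finiteness clause. *)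
Definition average_bounded_variation (f : R -> C) : Prop :=
  Rbar_locally p_infty (fun T : R => is_finite (variation f 0 T)) /\
  ex_finite_lim (fun T : R => / T * real (variation f 0 T)) p_infty.

(* Meaningful under [average_bounded_variation f]. *)
Definition average_variation (f : R -> C) : R :=
  real (Lim (fun T : R => / T * real (variation f 0 T)) p_infty).

(* Main.v *)
Require Import Defs.
From Stdlib Require Import Reals Lra Lia.
From Coquelicot Require Import Coquelicot.
Open Scope R_scope.

(** Fix [l <> 0], put [g x = f x * e^{-ilx}] and let [m] be the mean value of
    [g], which is the Fourier coefficient of [f] at [l].  In place of an
    integration by parts, the bound comes from comparing [f] with its translates.

    Mean values are translation invariant, so for [h > 0] the function
    [(f (x + h) - f x) e^{-ilx} = e^{ilh} g (x + h) - g x] has mean value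
    [(e^{ilh} - 1) m].  On the other hand, folding [[0, N h]] onto [[0, h]]
    gives
<<
      int_0^{Nh} |f (x + h) - f x| dx
        = int_0^h sum_{k < N} |f (x + (k+1) h) - f (x + k h)| dx
        <= h V_{[0, (N+1) h]} (f),
>>
    because for each [x] the inner sum runs over part of a partition of
    [[0, (N+1) h]].  Dividing by [N h] and letting [N] tend to infinity yields
    [|e^{ilh} - 1| |m| <= h L], where [L] is the average variation
    ([Cmod_mean_increment_le]).  Since [|e^{ilh} - 1| >= |sin (l h)|], division
    by [h] and [h -> 0] give [|l| |m| <= L] ([Rmult_le_of_Rabs_sin_le]).

    The Fourier coefficient is defined by unique choice, so the mean value must
    be shown to exist ([uap_mean_value]).  It is computed directly for
    [e^{i mu x}], extends to trigonometric polynomials by linearity, and passes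
    to uniform limits by completeness.  Multiplication by [e^{-ilx}] only shifts
    the frequencies of trigonometric polynomials, so [g] is again uniformly
    almost periodic. *)

(** * Complex-valued functions of a real variable *)

(** The complex numbers as a complete normed space over [R]; mean values are
    limits of integrals taken in this structure. *)
Notation CR := C_R_CompleteNormedModule.

Lemma norm_Cmod (z : C) : norm (V := CR) z = Cmod z.
Proof.
  change (sqrt (Rabs (fst z) ^ 2 + Rabs (snd z) ^ 2) = Cmod z).
  unfold Cmod. now rewrite 2!pow2_abs.
Qed.

Lemma Cmod_cis (x : R) : Cmod (cis x) = 1.
Proof.
  unfold Cmod, cis; simpl.
  replace (_ + _) with (Rsqr (sin x) + Rsqr (cos x)) by (unfold Rsqr; ring).
  rewrite sin2_cos2. apply sqrt_1.
Qed.

Lemma cis_plus (x y : R) : cis (x + y) = (cis x * cis y)%C.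
Proof.
  unfold cis, Cmult; simpl. rewrite cos_plus, sin_plus. f_equal; ring.
Qed.

Lemma cis_0 : cis 0 = RtoC 1.
Proof. unfold cis. now rewrite cos_0, sin_0. Qed.

Lemma Cmod_sub_triangle (x y z : C) :
  Cmod (x - z) <= Cmod (x - y) + Cmod (y - z).
Proof.
  replace (x - z)%C with ((x - y) + (y - z))%C by ring. apply Cmod_triangle.
Qed.

Lemma Cmod_sub_sym (x y : C) : Cmod (x - y) = Cmod (y - x).
Proof.
  replace (x - y)%C with (- (y - x))%C by ring. apply Cmod_opp.
Qed.

Lemma Cmod_scal_pos (r : R) (z : C) : 0 < r -> Cmod ((/ r)%R * z) = / r * Cmod z.
Proof.
  intros Hr. rewrite Cmod_mult, Cmod_R, Rabs_pos_eq; auto.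
  now apply Rlt_le, Rinv_0_lt_compat.
Qed.

Lemma continuous_pair (u v : R -> R) (x : R) :
  continuous u x -> continuous v x ->
  continuous (U := CR) (fun t => (u t, v t) : C) x.
Proof.
  intros Hu Hv. apply filterlim_locally. intros eps.
  generalize (proj1 (filterlim_locally _ _) Hu eps)
    (proj1 (filterlim_locally _ _) Hv eps).
  intros H1 H2. generalize (filter_and _ _ H1 H2).
  apply filter_imp. intros t Ht. exact Ht.
Qed.

Lemma continuous_Cmod_eps (g : R -> C) (x : R) :
  continuous (U := CR) g x <->
  forall eps : R, 0 < eps -> locally x (fun t => Cmod (g t - g x) < eps).
Proof.
  unfold continuous. rewrite (filterlim_locally_ball_norm (U := CR)).
  unfold ball_norm. split; intros H eps.
  - intros He. generalize (H (mkposreal eps He)). apply filter_imp.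
    intros t. rewrite norm_Cmod. exact (fun h => h).
  - generalize (H eps (cond_pos eps)). apply filter_imp.
    intros t. rewrite norm_Cmod. exact (fun h => h).
Qed.

Lemma continuous_Cmult_l (c : C) (g : R -> C) (x : R) :
  continuous (U := CR) g x -> continuous (U := CR) (fun t => c * g t)%C x.
Proof.
  rewrite 2!continuous_Cmod_eps. intros H eps He.
  assert (Hc := Cmod_ge_0 c).
  generalize (H (eps / (Cmod c + 1)) ltac:(apply Rdiv_lt_0_compat; lra)).
  apply filter_imp. intros t Ht.
  replace (c * g t - c * g x)%C with (c * (g t - g x))%C by ring.
  rewrite Cmod_mult.
  apply Rle_lt_trans with (Cmod c * (eps / (Cmod c + 1))).
  - apply Rmult_le_compat_l; lra.
  - apply Rmult_lt_reg_r with (Cmod c + 1); [lra|]. field_simplify; [|lra]. nra.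
Qed.

Lemma continuous_uniform_limit (g : R -> C) :
  (forall eps : R, 0 < eps -> exists p : R -> C,
    (forall x, continuous (U := CR) p x) /\ forall x, Cmod (g x - p x) < eps) ->
  forall x, continuous (U := CR) g x.
Proof.
  intros H x. apply continuous_Cmod_eps. intros eps He.
  destruct (H (eps / 3)) as [p [Hp Hgp]]; [lra|].
  generalize (proj1 (continuous_Cmod_eps p x) (Hp x) (eps / 3) ltac:(lra)).
  apply filter_imp. intros t Ht.
  generalize (Hgp t) (Hgp x) (Cmod_sub_triangle (g t) (p t) (g x))
    (Cmod_sub_triangle (p t) (p x) (g x)).
  rewrite (Cmod_sub_sym (p x)). lra.
Qed.

Lemma continuous_translate (g : R -> C) (h : R) :
  (forall x, continuous (U := CR) g x) ->
  forall x, continuous (U := CR) (fun t : R => g (t + h)%R) x.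
Proof.
  intros Cg x.
  apply (continuous_comp (U := R_UniformSpace) (V := R_UniformSpace)
    (fun t : R => t + h) g); [|apply Cg].
  apply (ex_derive_continuous (V := R_NormedModule)); auto_derive; auto.
Qed.

Lemma ex_RInt_Ccontinuous (g : R -> C) (a b : R) :
  (forall x, continuous (U := CR) g x) -> ex_RInt (V := CR) g a b.
Proof. intros H. apply ex_RInt_continuous. auto. Qed.

(** Integration is only linear over [R] in this structure; complex scalars are
    handled through the real and imaginary parts. *)
Lemma is_RInt_Cmult (c : C) (g : R -> C) (a b : R) (I : C) :
  is_RInt (V := CR) g a b I ->
  is_RInt (V := CR) (fun x => c * g x)%C a b (c * I)%C.
Proof.
  intros H.
  assert (H1 := is_RInt_fct_extend_fst (U := R_NormedModule) (V := R_NormedModule) g a b I H).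
  assert (H2 := is_RInt_fct_extend_snd (U := R_NormedModule) (V := R_NormedModule) g a b I H).
  apply (is_RInt_fct_extend_pair (U := R_NormedModule) (V := R_NormedModule)
    (fun x => c * g x)%C a b).
  - exact (is_RInt_minus _ _ _ _ _ _ (is_RInt_scal _ _ _ (fst c) _ H1)
             (is_RInt_scal _ _ _ (snd c) _ H2)).
  - exact (is_RInt_plus _ _ _ _ _ _ (is_RInt_scal _ _ _ (fst c) _ H2)
             (is_RInt_scal _ _ _ (snd c) _ H1)).
Qed.

(** * Mean values *)

Lemma is_mean_value_unique (g : R -> C) (m m' : C) :
  is_mean_value g m -> is_mean_value g m' -> m' = m.
Proof.
  intros H H'.
  assert (E : Cmod (m' - m) = 0).
  { apply Rle_antisym; [|apply Cmod_ge_0]. apply le_epsilon. intros eps He.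
    destruct (filter_ex (F := Rbar_locally p_infty) _
      (filter_and (F := Rbar_locally p_infty) _ _
    (H (eps / 2) ltac:(lra)) (H' (eps / 2) ltac:(lra))))
      as [T [HT HT']].
    generalize (HT 0) (HT' 0). clear HT HT'.
    set (z := (_ * RInt (V := CR) _ _ _)%C). intros HT HT'.
    generalize (Cmod_sub_triangle m' z m). rewrite (Cmod_sub_sym m' z). lra. }
  apply Cmod_eq_0 in E. replace m' with ((m' - m) + m)%C by ring.
  rewrite E. ring.
Qed.

Lemma mean_value_eq (g : R -> C) (m : C) :
  is_mean_value g m -> mean_value g = m.
Proof.
  intros H. apply (iota_unique (V := CR)); auto.
  intros y Hy. now apply (is_mean_value_unique g).
Qed.

Lemma is_mean_value_plus (g g' : R -> C) (m m' : C) :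
  (forall x, continuous (U := CR) g x) -> (forall x, continuous (U := CR) g' x) ->
  is_mean_value g m -> is_mean_value g' m' ->
  is_mean_value (fun x => g x + g' x)%C (m + m')%C.
Proof.
  intros Cg Cg' H H' eps He.
  generalize (filter_and (F := Rbar_locally p_infty) _ _
    (H (eps / 2) ltac:(lra)) (H' (eps / 2) ltac:(lra))).
  apply filter_imp. intros T [HT HT'] a. generalize (HT a) (HT' a).
  replace (RInt (V := CR) (fun x => g x + g' x)%C a (a + T))
    with (RInt (V := CR) g a (a + T) + RInt (V := CR) g' a (a + T))%C.
  2:{ symmetry. apply (RInt_plus (V := CR) g g'); now apply ex_RInt_Ccontinuous. }
  set (I := RInt (V := CR) g _ _). set (I' := RInt (V := CR) g' _ _). intros h h'.
  replace ((/ T)%R * (I + I') - (m + m'))%C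
    with (((/ T)%R * I - m) + ((/ T)%R * I' - m'))%C by ring.
  generalize (Cmod_triangle ((/ T)%R * I - m) ((/ T)%R * I' - m')). lra.
Qed.

Lemma is_mean_value_Cmult (c : C) (g : R -> C) (m : C) :
  (forall x, continuous (U := CR) g x) ->
  is_mean_value g m -> is_mean_value (fun x => c * g x)%C (c * m)%C.
Proof.
  intros Cg H eps He.
  assert (Hc := Cmod_ge_0 c).
  generalize (H (eps / (Cmod c + 1)) ltac:(apply Rdiv_lt_0_compat; lra)).
  apply filter_imp. intros T HT a.
  rewrite (is_RInt_unique (V := CR) _ _ _ _ (is_RInt_Cmult c g a (a + T) _
    (RInt_correct (V := CR) _ _ _ (ex_RInt_Ccontinuous g _ _ Cg)))).
  specialize (HT a). set (I := RInt (V := CR) g _ _) in *.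
  replace ((/ T)%R * (c * I) - c * m)%C with (c * ((/ T)%R * I - m))%C by ring.
  rewrite Cmod_mult.
  apply Rle_lt_trans with (Cmod c * (eps / (Cmod c + 1))).
  - apply Rmult_le_compat_l; lra.
  - apply Rmult_lt_reg_r with (Cmod c + 1); [lra|]. field_simplify; [|lra]. nra.
Qed.

(** The average of the translate over [[a, a + T]] is the average of [g] over
    [[a + h, a + h + T]]; uniformity in the left endpoint does the rest. *)
Lemma is_mean_value_translate (g : R -> C) (h : R) (m : C) :
  (forall x, continuous (U := CR) g x) ->
  is_mean_value g m -> is_mean_value (fun x : R => g (x + h)%R) m.
Proof.
  intros Cg H eps He. generalize (H eps He). apply filter_imp. intros T HT a.
  replace (RInt (V := CR) (fun x : R => g (x + h)%R) a (a + T))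
    with (RInt (V := CR) g (a + h) (a + h + T)); [apply HT|].
  symmetry. apply (is_RInt_unique (V := CR)).
  apply (is_RInt_ext (V := CR) (fun x => scal (V := CR) 1 (g (1 * x + h)%R))).
  - intros x _. rewrite (scal_one (V := CR)), Rmult_1_l. reflexivity.
  - apply (is_RInt_comp_lin (V := CR)).
    replace (1 * a + h) with (a + h) by ring.
    replace (1 * (a + T) + h) with (a + h + T) by ring.
    apply (RInt_correct (V := CR)), ex_RInt_Ccontinuous, Cg.
Qed.

Lemma continuous_cis_lin (mu x : R) :
  continuous (U := CR) (fun t => cis (t * mu)) x.
Proof.
  apply continuous_pair; apply (ex_derive_continuous (V := R_NormedModule)); auto_derive; auto.
Qed.

Lemma is_mean_value_cis_0 : is_mean_value (fun x => cis (x * 0)) (RtoC 1).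
Proof.
  intros eps He. exists 0. intros T HT a.
  replace (RInt (V := CR) (fun x => cis (x * 0)) a (a + T)) with (RtoC T).
  2:{ rewrite (RInt_ext (V := CR) _ (fun _ => RtoC 1)).
      - rewrite (RInt_const (V := CR)). unfold RtoC.
        change (scal _ _) with ((a + T - a) * 1, (a + T - a) * 0) at 1.
        f_equal; ring.
      - intros x _. now rewrite Rmult_0_r, cis_0. }
  replace ((/ T)%R * RtoC T - 1)%C with (RtoC 0).
  - now rewrite Cmod_0.
  - rewrite <- RtoC_mult, <- RtoC_minus. f_equal. field. lra.
Qed.

Lemma is_mean_value_cis (mu : R) :
  mu <> 0 -> is_mean_value (fun x => cis (x * mu)) (RtoC 0).
Proof.
  intros Hmu eps He.
  assert (Hm := Rabs_pos_lt mu Hmu).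
  exists (2 / (Rabs mu * eps)). intros T HT a.
  assert (HT0 : 0 < T).
  { apply Rlt_trans with (2 := HT), Rdiv_lt_0_compat; nra. }
  (* The integral of [cis (t * mu)] from [a] to [x], bounded by [2 / |mu|]. *)
  set (F := fun x => (Ci / mu * (cis (a * mu) - cis (x * mu)))%C).
  assert (HI : is_RInt (V := CR) (fun x => cis (x * mu)) a (a + T) (F (a + T))).
  { replace (F (a + T)) with
      ((sin ((a + T) * mu) / mu - sin (a * mu) / mu,
        - cos ((a + T) * mu) / mu - - cos (a * mu) / mu) : C).
    2:{ unfold F, cis, Cdiv, Cmult, Cminus, Cinv, Cplus, Copp, Ci, RtoC; simpl.
        f_equal; field; auto. }
    apply (is_RInt_fct_extend_pair (U := R_NormedModule) (V := R_NormedModule)); simpl.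
    - apply (is_RInt_derive (V := R_CompleteNormedModule) (fun x => sin (x * mu) / mu)).
      + intros x _. auto_derive; auto. field; auto.
      + intros x _. apply (ex_derive_continuous (V := R_NormedModule)); auto_derive; auto.
    - apply (is_RInt_derive (V := R_CompleteNormedModule) (fun x => - cos (x * mu) / mu)).
      + intros x _. auto_derive; auto. field; auto.
      + intros x _. apply (ex_derive_continuous (V := R_NormedModule)); auto_derive; auto. }
  rewrite (is_RInt_unique (V := CR) _ _ _ _ HI).
  replace ((/ T)%R * F (a + T)%R - 0)%C with ((/ T)%R * F (a + T)%R)%C by ring.
  rewrite Cmod_scal_pos by assumption. unfold F.
  rewrite Cmod_mult, Cmod_div by (intros E; apply Hmu; now apply RtoC_inj).
  rewrite Cmod_R.
  replace (Cmod Ci) with 1 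
    by (symmetry; unfold Cmod, Ci; simpl; replace (_ + _) with 1 by ring; apply sqrt_1).
  assert (HB : Cmod (cis (a * mu) - cis ((a + T) * mu)) <= 2).
  { apply Rle_trans with (1 := Cmod_triangle _ _).
    rewrite Cmod_opp, 2!Cmod_cis. lra. }
  apply Rle_lt_trans with (/ T * (1 / Rabs mu * 2)).
  - apply Rmult_le_compat_l; [now apply Rlt_le, Rinv_0_lt_compat|].
    apply Rmult_le_compat_l; [|exact HB].
    apply Rlt_le, Rdiv_lt_0_compat; lra.
  - apply Rmult_lt_reg_l with (T / eps); [apply Rdiv_lt_0_compat; lra|].
    replace (T / eps * eps) with T by (field; lra).
    replace (T / eps * _) with (2 / (Rabs mu * eps)) by (field; lra). exact HT.
Qed.

(** * Uniformly almost periodic functions *)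

Lemma trig_poly_S (n : nat) (c : nat -> C) (lam : nat -> R) (x : R) :
  trig_poly (S n) c lam x =
    (trig_poly n c lam x + c (S n) * cis (x * lam (S n)))%C.
Proof. unfold trig_poly. now rewrite sum_Sn. Qed.

Lemma trig_poly_0 (c : nat -> C) (lam : nat -> R) (x : R) :
  trig_poly 0 c lam x = (c 0%nat * cis (x * lam 0%nat))%C.
Proof. unfold trig_poly. now rewrite sum_O. Qed.

Lemma trig_poly_mult_cis (n : nat) (c : nat -> C) (lam : nat -> R) (l x : R) :
  (trig_poly n c lam x * cis (- (l * x)))%C =
    trig_poly n c (fun k => lam k - l) x.
Proof.
  assert (E : forall k, (c k * cis (x * lam k) * cis (- (l * x)))%C
    = (c k * cis (x * (lam k - l)))%C).
  { intros k. rewrite <- Cmult_assoc, <- cis_plus. do 2 f_equal. ring. }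
  induction n as [|n IH].
  - rewrite 2!trig_poly_0. apply E.
  - rewrite 2!trig_poly_S, <- IH, <- E. ring.
Qed.

Lemma continuous_trig_poly (n : nat) (c : nat -> C) (lam : nat -> R) (x : R) :
  continuous (U := CR) (trig_poly n c lam) x.
Proof.
  induction n as [|n IH].
  - eapply continuous_ext; [intros t; symmetry; apply trig_poly_0|].
    apply continuous_Cmult_l, continuous_cis_lin.
  - eapply continuous_ext; [intros t; symmetry; apply trig_poly_S|].
    apply (continuous_plus (V := CR)); [exact IH|].
    apply continuous_Cmult_l, continuous_cis_lin.
Qed.

Lemma is_mean_value_ext (g g' : R -> C) (m : C) :
  (forall x, g x = g' x) -> is_mean_value g m -> is_mean_value g' m.
Proof.
  intros E H eps He. generalize (H eps He). apply filter_imp. intros T HT a.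
  rewrite <- (RInt_ext (V := CR) g); auto.
Qed.

Lemma trig_poly_mean_value (n : nat) (c : nat -> C) (lam : nat -> R) :
  exists m, is_mean_value (trig_poly n c lam) m.
Proof.
  assert (Hmono : forall (a : C) mu, exists m, is_mean_value (fun x => a * cis (x * mu))%C m).
  { intros a mu. destruct (Req_dec mu 0) as [->|Hmu]; eexists;
      (apply is_mean_value_Cmult; [intros x; apply continuous_cis_lin|]).
    - apply is_mean_value_cis_0.
    - now apply is_mean_value_cis. }
  induction n as [|n [m IH]].
  - destruct (Hmono (c 0%nat) (lam 0%nat)) as [m Hm]. exists m.
    eapply is_mean_value_ext; [|exact Hm]. intros x; symmetry; apply trig_poly_0.
  - destruct (Hmono (c (S n)) (lam (S n))) as [m' Hm]. exists (m + m')%C.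
    eapply is_mean_value_ext; [intros x; symmetry; apply trig_poly_S|].
    apply is_mean_value_plus; auto.
    + intros x; apply continuous_trig_poly.
    + intros x; apply continuous_Cmult_l, continuous_cis_lin.
Qed.

Lemma continuous_uap (f : R -> C) :
  uniformly_almost_periodic f -> forall x, continuous (U := CR) f x.
Proof.
  intros H. apply continuous_uniform_limit. intros eps He.
  destruct (H eps He) as (n & c & lam & Hp). exists (trig_poly n c lam).
  split; auto. intros x; apply continuous_trig_poly.
Qed.

(** Modulation maps a trigonometric polynomial to one with shifted frequencies
    and leaves uniform distances unchanged. *)
Lemma uap_mult_cis (f : R -> C) (l : R) :
  uniformly_almost_periodic f ->
  uniformly_almost_periodic (fun x => f x * cis (- (l * x)))%C.
Proof.
  intros H eps He. destruct (H eps He) as (n & c & lam & Hp).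
  exists n, c, (fun k => lam k - l). intros x.
  rewrite <- trig_poly_mult_cis.
  replace (_ - _)%C with ((f x - trig_poly n c lam x) * cis (- (l * x)))%C by ring.
  rewrite Cmod_mult, Cmod_cis, Rmult_1_r. apply Hp.
Qed.

Lemma average_Cmod_le (g p : R -> C) (a T eps : R) :
  0 < T ->
  (forall x, continuous (U := CR) g x) -> (forall x, continuous (U := CR) p x) ->
  (forall x, Cmod (g x - p x) <= eps) ->
  Cmod ((/ T)%R * RInt (V := CR) g a (a + T) - (/ T)%R * RInt (V := CR) p a (a + T))
    <= eps.
Proof.
  intros HT Cg Cp Hgp.
  assert (H := is_RInt_minus (V := CR) _ _ _ _ _ _
    (RInt_correct (V := CR) _ a (a + T) (ex_RInt_Ccontinuous g _ _ Cg))
    (RInt_correct (V := CR) _ a (a + T) (ex_RInt_Ccontinuous p _ _ Cp))).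
  apply (norm_RInt_le_const (V := CR) _ _ _ _ eps) in H; [|lra|].
  2:{ intros x _. rewrite norm_Cmod. apply Hgp. }
  rewrite norm_Cmod in H.
  set (I := RInt (V := CR) g _ _) in *. set (J := RInt (V := CR) p _ _) in *.
  change (minus I J) with (I - J)%C in H.
  replace (_ - _)%C with ((/ T)%R * (I - J))%C by ring.
  rewrite Cmod_scal_pos by assumption.
  apply Rmult_le_reg_l with T; [assumption|].
  rewrite <- Rmult_assoc, Rinv_r, Rmult_1_l by lra. lra.
Qed.

(** The averages of [g] stay within [eps / 2] of those of an approximating
    trigonometric polynomial, uniformly in [a], so they satisfy a Cauchy
    condition.  The averages with [a = 0] therefore converge, and their limit
    serves for every [a]. *)
Lemma uap_mean_value (g : R -> C) :
  uniformly_almost_periodic g -> exists m, is_mean_value g m.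
Proof.
  intros H. assert (Cg := continuous_uap g H).
  set (avg := fun T a : R => ((/ T)%R * RInt (V := CR) g a (a + T))%C).
  assert (HC : forall eps, 0 < eps -> exists m : C, Rbar_locally p_infty
    (fun T => forall a, Cmod (avg T a - m) < eps)).
  { intros eps He. destruct (H (eps / 2) ltac:(lra)) as (n & c & lam & Hp).
    destruct (trig_poly_mean_value n c lam) as [m Hm]. exists m.
    generalize (filter_and (F := Rbar_locally p_infty) _ _ (Hm (eps / 2) ltac:(lra))
      (ex_intro _ 0 (fun x h => h) : Rbar_locally p_infty (fun T => 0 < T))).
    apply filter_imp. intros T [HT HT0] a. specialize (HT a).
    assert (HA := average_Cmod_le g (trig_poly n c lam) a T (eps / 2) HT0 Cg
      (continuous_trig_poly n c lam) (fun x => Rlt_le _ _ (Hp x))).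
    fold (avg T a) in HA. revert HT HA.
    set (z := (_ * RInt (V := CR) (trig_poly _ _ _) _ _)%C). intros HT HA.
    generalize (Cmod_sub_triangle (avg T a) z m). lra. }
  destruct (proj1 (filterlim_locally_cauchy (U := CR) (F := Rbar_locally p_infty)
    (fun T => avg T 0))) as [m Hm].
  { intros eps. destruct (HC (eps / 2)) as [m Hm].
    { generalize (cond_pos eps); lra. }
    eexists. split; [exact Hm|]. intros T T' HT HT'.
    apply (norm_compat1 (V := CR)). rewrite norm_Cmod.
    specialize (HT 0). specialize (HT' 0).
    generalize (Cmod_sub_triangle (avg T' 0) m (avg T 0)).
    rewrite (Cmod_sub_sym m).
    change (minus (avg T' 0) (avg T 0)) with (avg T' 0 - avg T 0)%C. lra. }
  exists m. intros eps He.
  destruct (HC (eps / 3) ltac:(lra)) as [m' Hm'].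
  assert (Hmm : Cmod (m' - m) < 2 * (eps / 3)).
  { assert (H0 := proj1 (filterlim_locally_ball_norm (U := CR) _ _) Hm
      (mkposreal (eps / 3) ltac:(lra))).
    destruct (filter_ex (F := Rbar_locally p_infty) _
      (filter_and (F := Rbar_locally p_infty) _ _ Hm' H0))
      as [T [HT HT']].
    unfold ball_norm in HT'. rewrite norm_Cmod in HT'. simpl in HT'.
    change (minus (avg T 0) m) with (avg T 0 - m)%C in HT'.
    specialize (HT 0). rewrite Cmod_sub_sym in HT.
    generalize (Cmod_sub_triangle m' (avg T 0) m). lra. }
  revert Hm'. apply filter_imp. intros T HT a. specialize (HT a).
  fold (avg T a). generalize (Cmod_sub_triangle (avg T a) m' m). lra.
Qed.

(** * Increments and variation *)

Lemma variation_sum_le (f : R -> C) (a b : R) (n : nat) (x : nat -> R) :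
  is_finite (variation f a b) -> is_partition a b n x ->
  variation_sum f n x <= real (variation f a b).
Proof.
  intros Hfin Hx.
  destruct (Lub_Rbar_correct (fun v => exists n x,
    is_partition a b n x /\ v = variation_sum f n x)) as [H _].
  specialize (H (variation_sum f n x) (ex_intro _ n (ex_intro _ x (conj Hx eq_refl)))).
  fold (variation f a b) in H. rewrite <- Hfin in H. exact H.
Qed.

(** The points [x, x + h, ..., x + (N+1) h], completed by the endpoints, form a
    partition.  The inequalities on [x] are strict because partition points are
    pairwise distinct; excluding [x = 0] and [x = h] costs nothing under an
    integral over [[0, h]]. *)
Lemma sum_increments_le_variation (f : R -> C) (N : nat) (x h : R) :
  0 < x < h ->
  is_finite (variation f 0 (INR (N + 2) * h)) ->
  sum_n (fun k => Cmod (f (x + INR k * h + h) - f (x + INR k * h))) N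
    <= real (variation f 0 (INR (N + 2) * h)).
Proof.
  intros Hx Hfin.
  set (y := fun i => match i with
    | O => 0
    | S k => if Nat.leb k (N + 1) then x + INR k * h else INR (N + 2) * h end).
  assert (Hy : is_partition 0 (INR (N + 2) * h) (S (S (S N))) y).
  { split; [reflexivity|split].
    - unfold y. destruct (Nat.leb_spec (S (S N)) (N + 1)); [lia|reflexivity].
    - intros [|k] Hk; unfold y.
      + simpl. lra.
      + destruct (Nat.leb_spec k (N + 1)); [|lia].
        destruct (Nat.leb_spec (S k) (N + 1)).
        * rewrite S_INR. lra.
        * replace k with (N + 1)%nat by lia.
          replace (N + 2)%nat with (S (N + 1)) by lia. rewrite S_INR. lra. }
  apply Rle_trans with (2 := variation_sum_le f _ _ _ _ Hfin Hy).
  unfold variation_sum.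
  rewrite sum_n_Sm, sum_Sn_m by lia.
  do 2 rewrite <- sum_n_m_S.
  match goal with |- _ <= plus (plus ?u ?v) ?w =>
    assert (0 <= u) by apply Cmod_ge_0; assert (0 <= w) by apply Cmod_ge_0;
    apply Rle_trans with v; [|change (v <= u + v + w); lra] end.
  apply Req_le. apply sum_n_m_ext_loc. intros k Hk.
  replace (S (S k) - 1)%nat with (S k) by lia. unfold y.
  destruct (Nat.leb_spec (S k) (N + 1)); [|lia].
  destruct (Nat.leb_spec k (N + 1)); [|lia].
  rewrite S_INR. do 3 f_equal. lra.
Qed.

Lemma continuous_increment (f : R -> C) (h : R) :
  (forall x, continuous (U := CR) f x) ->
  forall x, continuous (fun t => Cmod (f (t + h) - f t)) x.
Proof.
  intros Cf x.
  eapply continuous_ext; [intros t; apply norm_Cmod|].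
  apply (continuous_comp (U := R_UniformSpace) (V := CR)
    (fun t : R => f (t + h)%R - f t)%C (norm (V := CR))).
  - apply (continuous_minus (V := CR)); [|apply Cf].
    now apply continuous_translate.
  - apply (filterlim_norm (V := CR)).
Qed.

(** Additivity over the intervals [[k h, (k+1) h]], each translated to [[0, h]].
    [sum_n _ N] has [N + 1] terms, whence the upper limit [INR (S N) * h]. *)
Lemma is_RInt_fold (phi : R -> R) (h : R) (N : nat) :
  (forall x, continuous phi x) ->
  is_RInt (fun x => sum_n (fun k => phi (x + INR k * h)) N) 0 h
    (RInt phi 0 (INR (S N) * h)).
Proof.
  intros Hc.
  assert (Hex : forall a b, ex_RInt phi a b).
  { intros a b. apply (ex_RInt_continuous (V := R_CompleteNormedModule)). auto. }
  assert (Hk : forall k, is_RInt (fun x => phi (x + INR k * h)) 0 h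
    (RInt phi (INR k * h) (INR (S k) * h))).
  { intros k.
    apply (is_RInt_ext (V := R_NormedModule) (fun y => scal 1 (phi (1 * y + INR k * h)))).
    { intros x _. unfold scal; simpl. unfold mult; simpl.
      rewrite 2!Rmult_1_l. reflexivity. }
    apply (is_RInt_comp_lin (V := R_NormedModule)).
    replace (1 * 0 + INR k * h) with (INR k * h) by ring.
    replace (1 * h + INR k * h) with (INR (S k) * h) by (rewrite S_INR; ring).
    apply (RInt_correct (V := R_CompleteNormedModule)), Hex. }
  induction N as [|N IH].
  - generalize (Hk 0%nat). simpl INR. rewrite Rmult_0_l.
    apply is_RInt_ext. intros x _. rewrite sum_O. simpl. now rewrite Rmult_0_l.
  - rewrite <- (RInt_Chasles (V := R_CompleteNormedModule) phi 0 (INR (S N) * h)) by apply Hex.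
    eapply is_RInt_ext;
      [|exact (is_RInt_plus (V := R_NormedModule) _ _ _ _ _ _ IH (Hk (S N)))].
    intros x _. now rewrite sum_Sn.
Qed.

Lemma RInt_increment_le (f : R -> C) (N : nat) (h : R) :
  0 < h -> (forall x, continuous (U := CR) f x) ->
  is_finite (variation f 0 (INR (N + 2) * h)) ->
  RInt (fun x => Cmod (f (x + h) - f x)) 0 (INR (S N) * h)
    <= h * real (variation f 0 (INR (N + 2) * h)).
Proof.
  intros Hh Cf Hfin.
  assert (HI := is_RInt_fold (fun x => Cmod (f (x + h) - f x)) h N
    (continuous_increment f h Cf)).
  rewrite <- (is_RInt_unique (V := R_CompleteNormedModule) _ _ _ _ HI).
  set (V := real _).
  replace (h * V) with (RInt (fun _ => V) 0 h).
  2:{ rewrite RInt_const. change ((h - 0) * V = h * V). ring. }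
  apply RInt_le; [lra|eexists; exact HI|apply ex_RInt_const|].
  intros x Hx. now apply sum_increments_le_variation.
Qed.

Lemma modulated_increment (f : R -> C) (l h x : R) :
  (cis (l * h) * (f (x + h)%R * cis (- (l * (x + h))))
    + (-1)%R * (f x * cis (- (l * x))))%C
  = ((f (x + h)%R - f x) * cis (- (l * x)))%C.
Proof.
  replace (- (l * x)) with (l * h + - (l * (x + h))) by ring.
  rewrite cis_plus. ring.
Qed.

(** The left-hand side is the modulus of the mean value of
    [(f (x + h) - f x) e^{-ilx}]; its averages over [[0, N h]] are at most
    [V_{[0, (N+1) h]} (f) / N], whose limit is [h L]. *)
Lemma Cmod_mean_increment_le (f : R -> C) (l h L : R) (m : C) :
  0 < h -> (forall x, continuous (U := CR) f x) ->
  Rbar_locally p_infty (fun T => is_finite (variation f 0 T)) ->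
  is_lim (fun T => / T * real (variation f 0 T)) p_infty L ->
  (forall x, continuous (U := CR) (fun x => f x * cis (- (l * x)))%C x) ->
  is_mean_value (fun x => f x * cis (- (l * x)))%C m ->
  Cmod ((cis (l * h) - 1) * m) <= h * L.
Proof.
  intros Hh Cf Hfin HL Cg Hm. apply le_epsilon. intros eps He.
  set (g := fun x => (f x * cis (- (l * x)))%C) in *.
  set (D := fun x : R => (cis (l * h) * g (x + h)%R + (-1)%R * g x)%C).
  assert (CgD := fun x => continuous_Cmult_l (cis (l * h)) _ x
    (continuous_translate g h Cg x)).
  assert (CgN := fun x => continuous_Cmult_l (-1)%R g x (Cg x)).
  assert (CD : forall x, continuous (U := CR) D x).
  { intros x. exact (continuous_plus (V := CR) _ _ _ (CgD x) (CgN x)). }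
  assert (HD : is_mean_value D ((cis (l * h) - 1) * m)%C).
  { replace ((cis (l * h) - 1) * m)%C with (cis (l * h) * m + (-1)%R * m)%C
      by (replace (RtoC (-1)) with (- RtoC 1)%C
            by (rewrite <- RtoC_opp; f_equal; lra); ring).
    apply is_mean_value_plus; [exact CgD|exact CgN| |].
    - apply is_mean_value_Cmult; [now apply continuous_translate|].
      now apply is_mean_value_translate.
    - now apply is_mean_value_Cmult. }
  assert (Hk : forall k, is_lim_seq (fun N => INR (N + k) * h) p_infty).
  { intros k. apply (is_lim_seq_incr_n (fun N => INR N * h) k).
    replace p_infty with (Rbar_mult p_infty h)
      by now apply is_Rbar_mult_unique, is_Rbar_mult_p_infty_pos.
    apply is_lim_seq_scal_r, is_lim_seq_INR. }
  (* [(N + 2) / (N + 1)], the ratio of the length of the interval carrying the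
     variation to that of the interval of integration. *)
  assert (Hratio : is_lim_seq (fun N => 1 + / INR (S N)) 1).
  { replace (Finite 1) with (Finite (1 + 0)) by (f_equal; ring).
    apply is_lim_seq_plus'; [apply is_lim_seq_const|].
    replace (Finite 0) with (Rbar_inv p_infty) by reflexivity.
    apply is_lim_seq_inv; [|discriminate].
    apply (is_lim_seq_incr_1 INR), is_lim_seq_INR. }
  assert (HV : is_lim_seq (fun N => h * (1 + / INR (S N)) *
      (/ (INR (N + 2) * h) * real (variation f 0 (INR (N + 2) * h)))) (h * 1 * L)).
  { apply is_lim_seq_mult'.
    - apply is_lim_seq_mult'; [apply is_lim_seq_const|exact Hratio].
    - apply (is_lim_comp_seq _ _ p_infty L HL); [|apply Hk].
      exists 0%nat. intros N _. discriminate. }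
  cut (Rbar_le (Cmod ((cis (l * h) - 1) * m) - eps) (h * 1 * L)).
  { simpl. lra. }
  eapply is_lim_seq_le_loc; [|apply is_lim_seq_const|exact HV].
  assert (Hev := Hk 2%nat _ Hfin).
  assert (Hev1 := Hk 1%nat _ (HD eps He)).
  generalize (filter_and (F := eventually) _ _ Hev Hev1). apply filter_imp.
  intros N [HfinN HDN].
  replace (N + 1)%nat with (S N) in HDN by lia.
  assert (HSN : 0 < INR (S N)) by (apply lt_0_INR; lia).
  set (T := INR (S N) * h) in *.
  assert (HT : 0 < T) by (unfold T; nra).
  specialize (HDN 0). rewrite Rplus_0_l in HDN.
  set (I := RInt (V := CR) D 0 T) in *.
  assert (Hinc := RInt_increment_le f N h Hh Cf HfinN). fold T in Hinc.
  assert (HIle : Cmod I <= h * real (variation f 0 (INR (N + 2) * h))).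
  { apply Rle_trans with (2 := Hinc). rewrite <- norm_Cmod.
    apply (norm_RInt_le (V := CR) D (fun x => Cmod (f (x + h)%R - f x)) 0 T).
    - now apply Rlt_le.
    - intros x _. unfold D, g. rewrite modulated_increment.
      rewrite norm_Cmod, Cmod_mult, Cmod_cis, Rmult_1_r. apply Rle_refl.
    - apply (RInt_correct (V := CR)), ex_RInt_Ccontinuous, CD.
    - apply (RInt_correct (V := R_CompleteNormedModule)).
      apply (ex_RInt_continuous (V := R_CompleteNormedModule)).
      intros x _. now apply continuous_increment. }
  assert (Hmean : Cmod ((cis (l * h) - 1) * m) - eps <= / T * Cmod I).
  { rewrite <- Cmod_scal_pos by assumption.
    rewrite Cmod_sub_sym in HDN.
    set (z := ((cis (l * h) - 1) * m)%C) in *. set (w := ((/ T)%R * I)%C) in *.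
    generalize (Cmod_triangle (z - w) w).
    replace (z - w + w)%C with z by ring. lra. }
  apply Rle_trans with (1 := Hmean).
  apply Rle_trans with (/ T * (h * real (variation f 0 (INR (N + 2) * h)))).
  { apply Rmult_le_compat_l; [now apply Rlt_le, Rinv_0_lt_compat|assumption]. }
  apply Req_le. unfold T.
  replace (INR (N + 2)) with (INR (S N) + 1) by (rewrite <- S_INR; f_equal; lia).
  field. lra.
Qed.

Lemma Rabs_sin_le_Cmod_cis (t : R) : Rabs (sin t) <= Cmod (cis t - 1).
Proof.
  replace (sin t) with (snd (cis t - 1)%C) by (simpl; ring).
  apply Rle_trans with (2 := Rmax_Cmod _), Rmax_r.
Qed.

(** Let [h] tend to [0] along [h = |t| / |l|], using [sin t / t -> 1]. *)
Lemma Rmult_le_of_Rabs_sin_le (l c L : R) :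
  l <> 0 -> 0 <= c ->
  (forall h, 0 < h -> Rabs (sin (l * h)) * c <= h * L) ->
  Rabs l * c <= L.
Proof.
  intros Hl Hc H. assert (Hl' := Rabs_pos_lt l Hl).
  assert (Hlim : is_lim (fun t => sin t / t * (Rabs l * c)) 0 (1 * (Rabs l * c))).
  { apply (is_lim_scal_r (fun t => sin t / t) (Rabs l * c) 0 1), is_lim_sinc_0. }
  cut (Rbar_le (1 * (Rabs l * c)) L); [simpl; lra|].
  apply (is_lim_le_loc _ _ _ _ _) with (2 := Hlim) (3 := is_lim_const L 0).
  exists (mkposreal 1 Rlt_0_1). intros t _ Ht.
  assert (Ht' := Rabs_pos_lt t Ht).
  assert (Hh : 0 < Rabs t / Rabs l) by (apply Rdiv_lt_0_compat; lra).
  specialize (H _ Hh).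
  assert (E : Rabs (sin (l * (Rabs t / Rabs l))) = Rabs (sin t)).
  { assert (Hs : forall u, Rabs (sin (Rabs u)) = Rabs (sin u)).
    { intros u. unfold Rabs at 2. destruct (Rcase_abs u); auto.
      now rewrite sin_neg, Rabs_Ropp. }
    rewrite <- Hs, Rabs_mult, (Rabs_pos_eq (_ / _)), <- (Hs t) by lra.
    do 3 f_equal. field. lra. }
  rewrite E in H.
  apply Rle_trans with (Rabs (sin t) / Rabs t * (Rabs l * c)).
  - apply Rmult_le_compat_r; [nra|].
    rewrite <- Rabs_div by assumption. apply Rle_abs.
  - replace (Rabs (sin t) / Rabs t * (Rabs l * c))
      with (Rabs l / Rabs t * (Rabs (sin t) * c)) by (field; lra).
    apply Rle_trans with (Rabs l / Rabs t * (Rabs t / Rabs l * L)).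
    + apply Rmult_le_compat_l; [apply Rlt_le, Rdiv_lt_0_compat; lra|exact H].
    + apply Req_le. field. lra.
Qed.

Theorem theorem2 :
  forall f : R -> C,
    uniformly_almost_periodic f ->
    average_bounded_variation f ->
    forall (K : Type) (lam : K -> R) (A : K -> C),
      is_fourier_series f lam A ->
      forall j : K, lam j <> 0 ->
        Cmod (A j) <= average_variation f / Rabs (lam j).
Proof.
  intros f Hf [Hfin [L HL]] K lam A (_ & _ & HA) j Hj.
  rewrite HA. set (l := lam j) in *.
  assert (Hg := uap_mult_cis f l Hf).
  destruct (uap_mean_value _ Hg) as [m Hm].
  unfold fourier_coeff. rewrite (mean_value_eq _ m Hm).
  unfold average_variation. rewrite (is_lim_unique _ _ _ HL). simpl.
  assert (Hl := Rabs_pos_lt l Hj).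
  apply Rle_div_r; [assumption|]. rewrite Rmult_comm.
  apply Rmult_le_of_Rabs_sin_le; auto using Cmod_ge_0.
  intros h Hh.
  apply Rle_trans with (Cmod ((cis (l * h) - 1) * m)).
  - rewrite Cmod_mult. apply Rmult_le_compat_r; [apply Cmod_ge_0|].
    apply Rabs_sin_le_Cmod_cis.
  - apply (Cmod_mean_increment_le f); auto using continuous_uap.
Qed.
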